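(* Let $N\ge 3$, and consider a continuous-time Markov chain with state space $S=\{1,\dots,N\}$, infinitesimal generator $Q=(q_{ij})$ with $q_{ij}>0$ for all $i\ne j$, and a $1$-non-equilibrium invariant distribution $\pi$, that is, $\pi$ is a probability distribution with $\pi Q=0$ and $$\Pi Q-(\Pi Q)^{t}=d(\Lambda-\Lambda^{t})$$ for some real $d\neq 0$. Then the coordinates of $\pi$ are $$\pi_{1}=\Big(1+d\sum_{n=2}^{N}\sum_{i=1}^{n-1}\frac{1}{q_{i+1,i}}\prod_{j=i+1}^{n-1}\frac{q_{j,j+1}}{q_{j+1,j}}\Big)\Big(1+\sum_{n=2}^{N}\prod_{i=1}^{n-1}\frac{q_{i,i+1}}{q_{i+1,i}}\Big)^{-1},$$ and, for $2\le n\le N$, $$\pi_{n}=\pi_{1}\prod_{i=1}^{n-1}\frac{q_{i,i+1}}{q_{i+1,i}}-d\sum_{i=1}^{n-1}\frac{1}{q_{i+1,i}}\prod_{j=i+1}^{n-1}\frac{q_{j,j+1}}{q_{j+1,j}},$$ and the unique value of $d$ for which this holds is $$d=\frac{(-1)^{N+1}\Delta_{1,N+1}}{\sum_{i=2}^{N}(-1)^{N+1+i}\Delta_{i,N+1}-\Delta_{N+1,N+1}},$$ where $\Delta_{j,k}$ denotes the $(j,k)$ minor of the $(N+1)\times(N+1)$ matrix $$\left(\begin{array}{crcccr} 1&1&\cdots&\cdots&1&1\\ q_{1,2}&-q_{2,1}&0&\cdots&0&d\\ 0&q_{2,3}&-q_{3,2}&\cdots&0&d\\ \vdots&\vdots&&\ddots&\vdots&\vdots\\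 0&0&\cdots&q_{N-1,N}&-q_{N,N-1}&d\\ q_{1,N}&0&\cdots&0&-q_{N,1}&-d \end{array}\right).$$
   Context: An infinitesimal generator $Q=(q_{ij})$ on $S$ is a real matrix with $q_{ij}\ge 0$ for $i\ne j$ and $q_{ii}=-\sum_{j\neq i}q_{ij}$. $\Pi=\operatorname{diag}(\pi_1,\dots,\pi_N)$. $\Lambda=\operatorname{circ}(0,1,0,\dots,0)$ is the $N\times N$ cyclic permutation matrix: $\Lambda_{i,i+1}=1$ for $1\le i\le N-1$, $\Lambda_{N,1}=1$, all other entries $0$. Empty products equal $1$. The $(j,k)$ minor $\Delta_{j,k}$ is the (unsigned) determinant of the submatrix obtained by deleting row $j$ and column $k$; only minors with $k=N+1$ occur, and these do not depend on $d$. Precisely, the $(N+1)\times(N+1)$ matrix $B$ displayed in the claim has: first row all ones; for $1\le i\le N-1$, row $i+1$ has $B_{i+1,i}=q_{i,i+1}$, $B_{i+1,i+1}=-q_{i+1,i}$, $B_{i+1,N+1}=d$; row $N+1$ has $B_{N+1,1}=q_{1,N}$, $B_{N+1,N}=-q_{N,1}$, $B_{N+1,N+1}=-d$; all other entries are $0$. *)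

(* Defs.v *)
From HB Require Import structures.
From mathcomp Require Import all_boot all_order all_algebra.
From mathcomp Require Import reals.

Set Implicit Arguments.
Unset Strict Implicit.
Unset Printing Implicit Defensive.

Import Order.TTheory GRing.Theory Num.Theory.
Local Open Scope ring_scope.

(* The state space {1, ..., N} is 'I_N, the ordinal of value k standing for
   the state k + 1.  [entry A i j] is the coefficient A_{i,j} in the 1-based
   numbering; it is only meaningful for 1 <= i <= m and 1 <= j <= n (the index
   0 is read as 1, and indices beyond the size give 0). *)
Definition entry (R : nmodType) (m n : nat) (A : 'M[R]_(m, n)) (i j : nat) : R :=
  match insub i.-1, insub j.-1 with
  | Some r, Some c => A r c
  | _, _ => 0
  end.

Definition is_generator (R : realType) (N : nat) (Q : 'M[R]_N) : Prop :=
  (forall i j : 'I_N, i != j -> 0 <= Q i j) /\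
  (forall i : 'I_N, Q i i = - \sum_(j < N | j != i) Q i j).

Definition is_distribution (R : realType) (N : nat) (pi : 'rV[R]_N) : Prop :=
  (forall i : 'I_N, 0 <= pi ord0 i) /\ \sum_(i < N) pi ord0 i = 1.

Definition is_invariant (R : realType) (N : nat)
    (Q : 'M[R]_N) (pi : 'rV[R]_N) : Prop :=
  is_distribution pi /\ pi *m Q = 0.

(* [ordS] is the cyclic successor, so this is circ(0, 1, 0, ..., 0). *)
Definition Lambda (R : realType) (N : nat) : 'M[R]_N :=
  \matrix_(i < N, j < N) (j == ordS i)%:R.

Definition cyclic_flux (R : realType) (N : nat)
    (Q : 'M[R]_N) (pi : 'rV[R]_N) (d : R) : Prop :=
  diag_mx pi *m Q - (diag_mx pi *m Q)^T = d *: (Lambda R N - (Lambda R N)^T).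

Definition one_nonequilibrium (R : realType) (N : nat)
    (Q : 'M[R]_N) (pi : 'rV[R]_N) (d : R) : Prop :=
  [/\ is_invariant Q pi, d != 0 & cyclic_flux Q pi d].

(* The ordinal r is the row of 1-based index i + 1 with i = r, and c the
   column of 1-based index k = c + 1. *)
Definition flux_matrix (R : realType) (N : nat) (Q : 'M[R]_N) (d : R) :
    'M[R]_N.+1 :=
  \matrix_(r < N.+1, c < N.+1)
    let i := nat_of_ord r in
    let k := (nat_of_ord c).+1 in
    if i == 0%N then 1
    else if (i < N)%N then
      if k == i then entry Q i i.+1
      else if k == i.+1 then - entry Q i.+1 i
      else if k == N.+1 then d
      else 0
    else
      if k == 1%N then entry Q 1 N
      else if k == N then - entry Q N 1
      else if k == N.+1 then - d
      else 0.

(* Unsigned (j, k) minor in the 1-based numbering, for 1 <= j, k <= n + 1. *)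
Definition minor (R : realType) (n : nat) (A : 'M[R]_n.+1) (j k : nat) : R :=
  \det (row' (inord j.-1) (col' (inord k.-1) A)).

(* Main.v *)
(* The flux identities read pi_i q_{i,i+1} - pi_{i+1} q_{i+1,i} = d cyclically:
   the first N - 1 of them are an affine recurrence for pi, which with
   sum pi = 1 gives the closed form.  Together with sum pi = 1 they also say that
   (pi, -1) is in the kernel of the displayed matrix B, so det B = 0; expanding
   along the last column gives d * den = (-1)^(N+1) Delta_{1,N+1}.  Finally den
   is the determinant of B with last column (0, 1, ..., 1, -1).  A kernel vector
   (x, -t) of that matrix satisfies the flux identities with t in place of d, and
   sum x = 0; for t >= 0, x_1 <= 0 propagates forward to x <= 0 and x_1 > 0
   propagates backward around the cycle to x > 0, so x = 0 and t = 0. *)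
Require Import Defs.
From HB Require Import structures.
From mathcomp Require Import all_boot all_order all_algebra.
From mathcomp Require Import reals.
From mathcomp Require Import ring lra zify.

Set Implicit Arguments.
Unset Strict Implicit.
Unset Printing Implicit Defensive.

Import Order.TTheory GRing.Theory Num.Theory.
Local Open Scope ring_scope.

(** * Entries in the 1-based numbering *)

Lemma entryE (R : nmodType) (m n : nat) (A : 'M[R]_(m, n)) (i : 'I_m) (j : 'I_n) :
  entry A i.+1 j.+1 = A i j.
Proof. by rewrite /entry /= !valK. Qed.

Lemma entry_ord (R : nmodType) (m n i j : nat) (A : 'M[R]_(m, n))
    (hi : (i < m)%N) (hj : (j < n)%N) :
  entry A i.+1 j.+1 = A (Ordinal hi) (Ordinal hj).
Proof. exact: (entryE A (Ordinal hi) (Ordinal hj)). Qed.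

(** * Scalar recurrences along and around the cycle *)

Lemma affine_recurrence (F : fieldType) (N : nat) (a b p : nat -> F) (d : F)
    (b_neq0 : forall i, (1 <= i < N)%N -> b i != 0)
    (rec : forall i, (1 <= i < N)%N -> p i * a i - p i.+1 * b i = d) (n : nat) :
  (1 <= n <= N)%N ->
  p n = p 1%N * \prod_(1 <= i < n) (a i / b i)
        - d * \sum_(1 <= i < n) (1 / b i * \prod_(i.+1 <= j < n) (a j / b j)).
Proof.
case: n => // n; elim: n => [|n IHn] /andP[_ leN].
  by rewrite !big_geq // mulr1 mulr0 subr0.
have hn : (1 <= n.+1 < N)%N by apply: leN.
have bn0 := b_neq0 _ hn.
have -> : p n.+2 = p n.+1 * (a n.+1 / b n.+1) - d / b n.+1.
  by rewrite -(rec _ hn); field.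
rewrite IHn; last exact: ltnW.
rewrite [\prod_(1 <= i < n.+2) _]big_nat_recr //=.
rewrite [\sum_(1 <= i < n.+2) _]big_nat_recr //=.
(* The newest summand carries an empty product: it is the fresh term [d / b n.+1], while all older
   ones gain the factor [a n.+1 / b n.+1]. *)
rewrite [\prod_(n.+2 <= j < n.+2) _]big_geq // mulr1.
have -> : \sum_(1 <= i < n.+1) (1 / b i * \prod_(i.+1 <= j < n.+2) (a j / b j))
   = (\sum_(1 <= i < n.+1) (1 / b i * \prod_(i.+1 <= j < n.+1) (a j / b j)))
     * (a n.+1 / b n.+1).
  rewrite mulr_suml; apply: eq_big_nat => i /andP[_ lti].
  by rewrite big_nat_recr //= !mulrA.
ring.
Qed.

(** With [0 <= t], a nonpositive [x i] forces a nonpositive [x i.+1], and a positive [x i.+1] forces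
    a positive [x i]. Starting from the sign of [x 1], all coordinates share one sign, which the
    zero sum allows only if they vanish. *)
Lemma cyclic_system_inj (R : realFieldType) (N : nat) (a b x : nat -> R)
    (a0 b0 t : R) (hN : (1 <= N)%N)
    (a_gt0 : forall i, (1 <= i < N)%N -> 0 < a i)
    (b_gt0 : forall i, (1 <= i < N)%N -> 0 < b i)
    (a0_gt0 : 0 < a0) (b0_gt0 : 0 < b0)
    (step : forall i, (1 <= i < N)%N -> x i * a i - x i.+1 * b i = t)
    (wrap : x N * b0 - x 1%N * a0 = t)
    (sum0 : \sum_(1 <= i < N.+1) x i = 0) :
  forall i, (1 <= i <= N)%N -> x i = 0.
Proof.
(* The system is linear, so negating [x] and [t] together preserves it. *)
wlog t_ge0 : x t step wrap sum0 / 0 <= t.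
  move=> W; have [|t_lt0] := leP 0 t; first exact: W step wrap sum0.
  move=> i hi; apply/eqP; rewrite -oppr_eq0; apply/eqP.
  apply: (W (fun i => - x i) (- t)) hi.
  - by move=> j hj; rewrite -(step j hj); ring.
  - by rewrite -wrap; ring.
  - by rewrite sumrN sum0 oppr0.
  - by rewrite oppr_ge0 ltW.
have [x1_le0|x1_gt0] := leP (x 1%N) 0.
  have x_le0 i : (1 <= i <= N)%N -> x i <= 0.
    case: i => // i; elim: i => // i IHi /andP[_ iN].
    have hi : (1 <= i.+1 < N)%N by apply: iN.
    have xi := IHi (ltnW iN); have := step _ hi.
    move: (a_gt0 _ hi) (b_gt0 _ hi) => ai bi e.
    rewrite -(pmulr_lle0 _ bi).
    have : x i.+1 * a i.+1 <= 0 by rewrite pmulr_lle0.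
    lra.
  have /eqP : \sum_(1 <= i < N.+1) - x i = 0 by rewrite sumrN sum0 oppr0.
  rewrite big_nat_cond psumr_eq0; last first.
    by move=> i; rewrite andbT => hi; rewrite oppr_ge0 x_le0.
  move=> /allP xs0 i hi; apply/eqP; rewrite -oppr_eq0.
  by have := xs0 i; rewrite mem_index_iota andbT !ltnS hi; apply.
(* Induction runs backwards from [N]; the base case comes from [wrap], which gives
   [x N * b0 = x 1 * a0 + t > 0]. *)
have x_gt0 k : (k < N)%N -> 0 < x (N - k)%N.
  elim: k => [_|k IHk kN].
    rewrite subn0 -(pmulr_lgt0 _ b0_gt0).
    have := mulr_gt0 x1_gt0 a0_gt0; lra.
  have hk : (1 <= N - k.+1 < N)%N.
    by rewrite subn_gt0 kN ltn_subrL.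
  have eS : (N - k.+1).+1 = (N - k)%N by rewrite subnSK // ltnW.
  have xk := IHk (ltnW kN); have := step _ hk; rewrite eS => e.
  move: (a_gt0 _ hk) (b_gt0 _ hk) => ai bi.
  rewrite -(pmulr_lgt0 _ ai).
  have := mulr_gt0 xk bi; lra.
have : 0 < \sum_(1 <= i < N.+1) x i.
  rewrite big_ltn // ltr_wpDr //.
  rewrite big_nat_cond sumr_ge0 // => i /andP[/andP[i1 iN] _].
  have -> : i = (N - (N - i))%N by rewrite subKn.
  by rewrite ltW // x_gt0 // ltn_subrL (ltnW i1).
by rewrite sum0 ltxx.
Qed.

(** * Expansion along a replaceable last column *)

Lemma det_last_col (R : realType) (n : nat) (A : 'M[R]_n.+1) :
  \det A = \sum_(1 <= i < n.+2)
             entry A i n.+1 * ((-1) ^+ (n + 1 + i) * minor A i n.+1).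
Proof.
rewrite (expand_det_col _ ord_max) big_add1 /= big_mkord.
apply: eq_bigr => i _; rewrite (entryE A i ord_max) /cofactor /minor /=.
rewrite inord_val (_ : inord n = ord_max); last first.
  by apply: val_inj; rewrite /= inordK.
congr (_ * (_ * _)).
(* The 1-based exponent exceeds the 0-based cofactor exponent by 2, so the signs agree. *)
by rewrite addn1 addSn addnS !exprS !mulN1r opprK addnC.
Qed.

Lemma sum_delta (R : pzSemiRingType) (N i : nat) (f : nat -> R) (hi : (i < N)%N) :
  \sum_(c < N) (val c == i)%:R * f c = f i.
Proof.
rewrite (bigD1 (Ordinal hi)) //= eqxx mul1r big1 ?addr0 // => c.
by rewrite -val_eqE /= => /negbTE->; rewrite mul0r.
Qed.

Lemma det0_colP (F : fieldType) (n : nat) (A : 'M[F]_n) :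
  reflect (exists2 u : 'cV_n, u != 0 & A *m u = 0) (\det A == 0).
Proof.
rewrite -det_tr; apply: (iffP det0P) => [[v v0 vA]|[u u0 Au]].
  by exists v^T; rewrite ?trmx_eq0 // -[A]trmxK -trmx_mul vA trmx0.
by exists u^T; rewrite ?trmx_eq0 // -trmx_mul Au trmx0.
Qed.

(** The new column [v] is indexed from 1. Varying only this column gives determinants that are
    linear in [v]. *)
Definition set_last_col (R : Type) (n : nat) (A : 'M[R]_n.+1) (v : nat -> R) :
    'M[R]_n.+1 :=
  \matrix_(i, j) if j == ord_max then v i.+1 else A i j.

(** Deleting the last column removes the replacement, so the coefficients of [v] are the minors of
    [A] itself. *)
Lemma det_set_last_col (R : realType) (n : nat) (A : 'M[R]_n.+1) (v : nat -> R) :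
  \det (set_last_col A v) =
    \sum_(1 <= i < n.+2) v i * ((-1) ^+ (n + 1 + i) * minor A i n.+1).
Proof.
rewrite det_last_col !big_add1 /= !big_mkord; apply: eq_bigr => i _.
rewrite (entryE _ i ord_max) mxE eqxx; congr (_ * (_ * \det _)).
apply/matrixP => r c; rewrite !mxE ifF //.
have -> : ord_max = inord n.+1.-1 :> 'I_n.+1 by apply: val_inj; rewrite /= inordK.
by rewrite eq_sym; apply/negbTE/neq_lift.
Qed.

(** * The displayed matrix and the flux identities *)

Lemma flux_matrixE (R : realType) (N : nat) (Q : 'M[R]_N) (d : R)
    (hN : (1 < N)%N) :
  flux_matrix Q d =
  set_last_col (flux_matrix Q d)
    (fun i => if i == 1%N then 1 else if (i <= N)%N then d else - d).
Proof.
apply/matrixP => r c; rewrite [in RHS]mxE; case: eqP => // ->.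
rewrite mxE /= [r.+1 == 1%N]eqSS; case: ifP => // r0.
by case: ifP => rN; rewrite !eqxx !gtn_eqF // ltnW.
Qed.

(** Rows 2 to N yield the flux differences along the cycle. The last row yields the closing
    difference with reversed orientation, which explains the sign of its entry [- d]. *)
Lemma mul_flux_matrix (R : realType) (N : nat) (Q : 'M[R]_N) (d : R)
    (v x : nat -> R) (r : 'I_N.+1) (hN : (1 < N)%N) :
  let q := entry Q in
  (set_last_col (flux_matrix Q d) v *m \col_(c < N.+1) x c.+1) r ord0 =
  (if val r == 0%N then \sum_(1 <= i < N.+1) x i
   else if (r < N)%N then x r * q r r.+1 - x r.+1 * q r.+1 r
   else x 1%N * q 1%N N - x N * q N 1%N) + v r.+1 * x N.+1.
Proof.
move=> q; rewrite mxE big_ord_recr /= !mxE eqxx; congr (_ + _).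
(* Nested tests become a difference of indicators because the two nonzero positions in a row are
   distinct; in the last row this is [1 < N]. *)
have eqE (c : 'I_N) :
    set_last_col (flux_matrix Q d) v r (widen_ord (leqnSn N) c) =
    if val r == 0%N then 1
    else if (r < N)%N then (val c == r.-1)%:R * q r r.+1 - (val c == r)%:R * q r.+1 r
    else (val c == 0%N)%:R * q 1%N N - (val c == N.-1)%:R * q N 1%N.
  have cN := ltn_ord c.
  rewrite !mxE -val_eqE /= ltn_eqF //; case: eqP => // /eqP r0.
  have [m em] : exists m, val r = m.+1 by exists r.-1; rewrite prednK ?lt0n.
  case: ifP => rN.
    rewrite em !eqSS /= (ltn_eqF cN); case: eqP => [->|_].
      by rewrite (ltn_eqF (ltnSn m)) mul1r mul0r subr0.
    by rewrite mul0r sub0r; case: eqP; rewrite ?mul1r ?mul0r ?oppr0.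
  rewrite !eqSS (ltn_eqF cN); case: eqP => [->|_].
    by rewrite ltn_eqF ?mul1r ?mul0r ?subr0 // -ltnS prednK // ltnW.
  rewrite -(eqSS c) prednK; last exact: ltnW.
  by rewrite mul0r sub0r; case: eqP; rewrite ?mul1r ?mul0r ?oppr0.
under eq_bigr => c _ do rewrite eqE mxE /=.
case: ifP => [_|r0].
  by rewrite big_add1 big_mkord; apply: eq_bigr => c _; rewrite mul1r.
have N0 : (N.-1 < N)%N by rewrite prednK // ltnW.
have rp : (r.-1).+1 = r by rewrite prednK // lt0n r0.
have sumE (i j : nat) (s t : R) : (i < N)%N -> (j < N)%N ->
   \sum_(c < N) ((val c == i)%:R * s - (val c == j)%:R * t) * x c.+1
     = x i.+1 * s - x j.+1 * t.
  move=> hi hj; under eq_bigr => c _ do rewrite mulrBl -!mulrA.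
  by rewrite sumrB !(sum_delta (fun c => _ * x c.+1)) // ![_ * x _]mulrC.
case: ifP => rN; first by rewrite sumE ?rp // ltnW.
by rewrite sumE ?prednK // ltnW.
Qed.

(** These are the entries (i, i+1) and (N, 1) of the matrix identity. *)
Lemma cyclic_fluxP (R : realType) (N : nat) (Q : 'M[R]_N) (pi : 'rV[R]_N) (d : R)
    (hN : (2 < N)%N) (flux : cyclic_flux Q pi d) :
  let q := entry Q in
  let p := entry pi 1 in
  (forall i, (1 <= i < N)%N -> p i * q i i.+1 - p i.+1 * q i.+1 i = d) /\
  p N * q N 1%N - p 1%N * q 1%N N = d.
Proof.
have E (i j : 'I_N) : pi ord0 i * Q i j - pi ord0 j * Q j i =
    d * ((j == ordS i)%:R - (i == ordS j)%:R).
  by have /matrixP/(_ i j) := flux; rewrite mul_diag_mx !mxE.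
have EN i j (hi : (i < N)%N) (hj : (j < N)%N) :
    entry pi 1 i.+1 * entry Q i.+1 j.+1 - entry pi 1 j.+1 * entry Q j.+1 i.+1 =
    d * ((j == i.+1 %% N)%N%:R - (i == j.+1 %% N)%N%:R).
  have := E (Ordinal hi) (Ordinal hj); rewrite -!val_eqE /= => <-.
  by rewrite (entry_ord Q hi hj) (entry_ord Q hj hi) (entryE pi ord0 (Ordinal hi))
    (entryE pi ord0 (Ordinal hj)).
split=> [[|i] // /andP[_ iN]|].
  rewrite EN ?(ltnW iN) // modn_small // eqxx.
  (* As N is at least 3, no edge of the cycle is also its own reverse, so only one indicator
     survives. *)
  suff -> : (i == i.+2 %% N)%N = false by rewrite subr0 mulr1.
  move: iN; rewrite leq_eqVlt => /predU1P[eN|iN].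
    by rewrite eN modnn gtn_eqF // -ltnS -ltnS eN.
  by rewrite modn_small //; lia.
have N0 : (N.-1 < N)%N by lia.
have := EN N.-1 0%N N0 (ltnW (ltnW hN)); rewrite prednK; last by lia.
rewrite modnn modn_small; last by lia.
by rewrite eqxx (_ : (N.-1 == 1)%N = false) ?subr0 ?mulr1 //; lia.
Qed.

(** A single flux identity already expresses the constant through [pi] and [Q]. *)
Lemma cyclic_flux_inj (R : realType) (N : nat) (Q : 'M[R]_N) (pi : 'rV[R]_N)
    (d d' : R) (hN : (2 < N)%N) :
  cyclic_flux Q pi d -> cyclic_flux Q pi d' -> d' = d.
Proof.
by move=> /(cyclic_fluxP hN)[_ <-] /(cyclic_fluxP hN)[_ <-].
Qed.

(** * The two determinants: nonzero denominator and vanishing [det B] *)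

Lemma det_flux_direction_neq0 (R : realType) (N : nat) (Q : 'M[R]_N) (d : R)
    (hN : (1 < N)%N) (hQpos : forall i j : 'I_N, i != j -> 0 < Q i j) :
  \det (set_last_col (flux_matrix Q d)
     (fun i => if i == 1%N then 0 else if (i <= N)%N then 1 else -1)) != 0.
Proof.
have q_gt0 i j : (i < N)%N -> (j < N)%N -> i != j -> 0 < entry Q i.+1 j.+1.
  by move=> hi hj ij; rewrite entry_ord hQpos.
apply/negP => /det0_colP[u u0 Au].
pose x i := entry u i 1.
have ux : u = \col_(c < N.+1) x c.+1.
  by apply/matrixP => i j; rewrite mxE /x (ord1 j) (entryE u i ord0).
have row (r : 'I_N.+1) := congr1 (fun M : 'cV_N.+1 => M r ord0) Au.
rewrite ux in row.
have {}row r := etrans (esym (mul_flux_matrix _ _ _ _ _ hN)) (row r).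
have row_nat r (hr : (r < N.+1)%N) := row (Ordinal hr).
have x0 : forall i, (1 <= i <= N)%N -> x i = 0.
  (* The last coordinate multiplies the column (0, 1, ..., 1, -1), so the kernel equations are the
     cyclic system with [t = - x N.+1]. *)
  apply: (@cyclic_system_inj R N (fun i => entry Q i i.+1)
           (fun i => entry Q i.+1 i) x (entry Q 1 N) (entry Q N 1) (- x N.+1)).
  - exact: ltnW.
  - by case=> // i /andP[_ hi]; apply: q_gt0; lia.
  - by case=> // i /andP[_ hi]; apply: q_gt0; lia.
  - by have := q_gt0 0%N N.-1; rewrite prednK; [apply; lia | lia].
  - by have := q_gt0 N.-1 0%N; rewrite prednK; [apply; lia | lia].
  - case=> // i /andP[_ hi]; have := row_nat i.+1 (ltnW hi).
    by rewrite mxE /= hi mul1r => /eqP; rewrite addr_eq0 => /eqP.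
  - have := row_nat N (ltnSn N).
    rewrite mxE /= gtn_eqF ?(ltnW hN) // ltnn eqSS gtn_eqF ?(ltnW hN) //; lra.
  - by have := row_nat 0%N (ltn0Sn N); rewrite mxE /= mul0r addr0.
(* Row 2 of the kernel equation reduces to this once [x 1] and [x 2] vanish. *)
have xN : x N.+1 = 0.
  have := row_nat 1%N (ltnW hN).
  by rewrite mxE /= hN (x0 1%N) ?(x0 2) ?(ltnW hN) // !mul0r subr0 add0r mul1r.
case/eqP: u0; rewrite ux; apply/matrixP => i j; rewrite !mxE.
have := ltn_ord i; rewrite ltnS leq_eqVlt => /predU1P[->|hi] //.
exact: x0.
Qed.

Lemma det_flux_matrix_eq0 (R : realType) (N : nat) (Q : 'M[R]_N) (pi : 'rV[R]_N)
    (d : R) (hN : (2 < N)%N) :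
  cyclic_flux Q pi d -> \sum_(i < N) pi ord0 i = 1 -> \det (flux_matrix Q d) = 0.
Proof.
move=> /(cyclic_fluxP hN)[step wrap] sum1.
(* The first N columns applied to [pi] give (1, d, ..., d, -d), which is the last column; the
   coordinate -1 cancels it. *)
pose x i := if i == N.+1 then -1 else entry pi 1 i.
have xE i : (i <= N)%N -> x i = entry pi 1 i.
  by move=> hi; rewrite /x ltn_eqF.
have xN : x N.+1 = -1 by rewrite /x eqxx.
apply/eqP/det0_colP; exists (\col_(c < N.+1) x c.+1).
  apply/eqP => /matrixP/(_ ord_max ord0)/eqP.
  by rewrite !mxE /x eqxx oppr_eq0 oner_eq0.
rewrite (flux_matrixE _ _ (ltnW hN)); apply/matrixP => r j.
rewrite (ord1 j) mul_flux_matrix ?(ltnW hN) // [RHS]mxE xN /=.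
have := ltn_ord r; rewrite ltnS => rN.
case: ifP => [/eqP->|r0] /=.
  rewrite mul1r big_add1 big_mkord -sum1 -sumrB big1 // => i _.
  by rewrite xE // (entryE pi ord0 i) subrr.
rewrite eqSS r0; case: ifP => rN'.
  by rewrite !xE // step ?lt0n ?r0 // mulrN1 subrr.
by rewrite !xE ?(ltnW (ltnW hN)) // mulrN1 opprK -wrap addrC subrKA subrr.
Qed.

(** One formula serves twice: [(a, b) = (1, d)] gives [det B], and [(0, 1)] gives the denominator of
    the formula for d. *)
Lemma det_flux_last_col (R : realType) (N : nat) (A : 'M[R]_N.+1) (a b : R)
    (hN : (0 < N)%N) :
  \det (set_last_col A
     (fun i => if i == 1%N then a else if (i <= N)%N then b else - b)) =
  a * ((-1) ^+ N * minor A 1 N.+1) +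
  b * (\sum_(2 <= i < N.+1) (-1) ^+ (N + 1 + i) * minor A i N.+1
       - minor A N.+1 N.+1).
Proof.
rewrite det_set_last_col big_ltn // big_nat_recr //= ltnn eqSS gtn_eqF //.
have -> : (-1) ^+ (N + 1 + 1) = (-1) ^+ N :> R.
  by rewrite !addn1 !exprS !mulN1r opprK.
have -> : (-1) ^+ (N + 1 + N.+1) = 1 :> R.
  by rewrite addn1 -signr_odd addnn odd_double.
rewrite mul1r mulNr mulrBr; congr (_ + (_ + _)).
rewrite mulr_sumr; apply: eq_big_nat => i /andP[i1 iN].
by rewrite gtn_eqF // -ltnS iN.
Qed.

(** * Closed form of the distribution and value of d *)

Theorem theorem3 (R : realType) (N : nat) (hN : (3 <= N)%N)
    (Q : 'M[R]_N) (pi : 'rV[R]_N) (d : R)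
    (hQ : is_generator Q)
    (hQpos : forall i j : 'I_N, i != j -> 0 < Q i j)
    (hpi : one_nonequilibrium Q pi d) :
  let q := entry Q in
  let p := entry pi 1 in
  let Delta := minor (flux_matrix Q d) in
  let den := \sum_(2 <= i < N.+1) (-1) ^+ (N + 1 + i) * Delta i N.+1
             - Delta N.+1 N.+1 in
  [/\ p 1%N =
        (1 + d * \sum_(2 <= n < N.+1) \sum_(1 <= i < n)
                   (1 / q i.+1 i
                    * \prod_(i.+1 <= j < n) (q j j.+1 / q j.+1 j)))
        * (1 + \sum_(2 <= n < N.+1)
                 \prod_(1 <= i < n) (q i i.+1 / q i.+1 i))^-1,
      forall n : nat, (2 <= n <= N)%N ->
        p n = p 1%N * \prod_(1 <= i < n) (q i i.+1 / q i.+1 i)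
              - d * \sum_(1 <= i < n)
                      (1 / q i.+1 i
                       * \prod_(i.+1 <= j < n) (q j j.+1 / q j.+1 j)),
      den != 0 &
      forall d' : R,
        cyclic_flux Q pi d' <-> d' = (-1) ^+ N.+1 * Delta 1%N N.+1 / den].
Proof.
move=> q p Delta den.
case: hpi => -[[_ sum1] _] _ flux.
have [step _] := cyclic_fluxP hN flux.
have q_gt0 i : (1 <= i < N)%N -> 0 < q i i.+1 /\ 0 < q i.+1 i.
  case: i => // i /andP[_ iN].
  by rewrite /q !entry_ord ?(ltnW iN) // => h; split; apply: hQpos;
    rewrite -val_eqE /= ?(gtn_eqF (ltnSn i)) ?(ltn_eqF (ltnSn i)).
have pE n : (1 <= n <= N)%N ->
    p n = p 1%N * \prod_(1 <= i < n) (q i i.+1 / q i.+1 i)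
          - d * \sum_(1 <= i < n)
                  (1 / q i.+1 i * \prod_(i.+1 <= j < n) (q j j.+1 / q j.+1 j)).
  apply: (affine_recurrence (b := fun i => q i.+1 i)) => // i hi.
  by rewrite gt_eqF //; case: (q_gt0 i hi).
have detE a b := det_flux_last_col (flux_matrix Q d) a b (ltnW (ltnW hN)).
have den_neq0 : den != 0.
  have := det_flux_direction_neq0 d (ltnW hN) hQpos.
  by rewrite detE mul0r add0r mul1r.
(* The vanishing of [det B] reads [(-1) ^+ N * Delta 1 N.+1 + d * den = 0]; moving the first term
   across raises the exponent to N+1. *)
have dE : d = (-1) ^+ N.+1 * Delta 1%N N.+1 / den.
  have := det_flux_matrix_eq0 hN flux sum1.
  rewrite (flux_matrixE _ _ (ltnW hN)) detE -/Delta -/den mul1r => e.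
  apply/(canRL (mulfK den_neq0)); rewrite exprS; lra.
split=> // [|n /andP[n2 nN]|d']; first last.
- by rewrite -dE; split=> [/(cyclic_flux_inj hN flux)|->].
- by rewrite pE // nN (ltnW n2).
have sum_p : p 1%N * (1 + \sum_(2 <= n < N.+1)
                 \prod_(1 <= i < n) (q i i.+1 / q i.+1 i))
    = 1 + d * \sum_(2 <= n < N.+1) \sum_(1 <= i < n)
                   (1 / q i.+1 i
                    * \prod_(i.+1 <= j < n) (q j j.+1 / q j.+1 j)).
  have sum_p1 : \sum_(1 <= n < N.+1) p n = 1.
    rewrite -sum1 big_add1 big_mkord; apply: eq_bigr => i _.
    by rewrite /p (entryE pi ord0 i).
  (* The split-off term [p 1] accounts for the leading 1 in the normalising factor. *)
  have := sum_p1; rewrite big_ltn; last by lia.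
  under eq_big_nat => n /andP[n2 nN].
    rewrite pE ?(ltnW n2) //; over.
  rewrite sumrB -!mulr_sumr; lra.
(* The normalising factor is 1 plus nonnegative products, hence invertible. *)
rewrite -sum_p mulfK // gt_eqF // ltr_wpDr // big_nat_cond sumr_ge0 // => n.
rewrite andbT => /andP[_ nN]; rewrite big_nat_cond prodr_ge0 // => i.
rewrite andbT => /andP[i1 iN].
have [a_gt0 b_gt0] : 0 < q i i.+1 /\ 0 < q i.+1 i by apply: q_gt0; lia.
by rewrite divr_ge0 // ltW.
Qed.
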